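(* In the setting and in the $\Delta$-adapted local chart of the context, let $\mathcal I$ be a time interval, let $u:\mathcal I\to\mathbb{R}^M$ be a $C^1$ control function, let $q:\mathcal I\to\mathbb{R}^{N+M}$ be a $C^1$ path (with values in the chart), and set $p(t)\doteq g_{q(t)}(\dot q(t))$. Then the path $(q,p):\mathcal I\to T^*\mathcal{Q}$ satisfies, for some reaction $R(t)$, the nonholonomic equations $$\dot q=\frac{\partial H}{\partial p}(q,p),\quad \dot p=-\frac{\partial H}{\partial q}(q,p)+F(t,q,p)+R(t),\quad \pi(q(t))=u(t),\quad p(t)\in g_{q(t)}(\Gamma_{q(t)}),\quad R(t)\in\ker\Delta_{q(t)}+\ker\Gamma_{q(t)}$$ for all $t\in\mathcal I$ if and only if the following two conditions are satisfied: (i) The components $\dot q_J\doteq P_J(\dot q)$ and $p_J\doteq P_J^*(p)$, $J\in\{I,II,III\}$, satisfy on $\mathcal I$ $$\dot q_{II}=0,\qquad \dot q_{III}=h(\dot u)\qquad(\text{equivalently } p_{II}=0,\ p_{III}=k(\dot u)),$$ $$\dot q_I=g^{-1}(p_I),\qquad \frac{d}{dt}\big(P_I^*(p)\big)=\theta_I[p_I,p_I]+\Upsilon[p_I,\dot u]+\Psi[\dot u,\dot u]+F_I .$$ (ii) At some time $t_0\in\mathcal I$ one has $q^{N+\alpha}(t_0)=u^\alpha(t_0)$ for all $\alpha=1,\dots,M$.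
   Context: Setting. $N,M,\nu$ are positive integers. $\mathcal{Q}$ is a smooth manifold of dimension $N+M$ with a smooth Riemannian metric $\mathbf g$. $\mathcal{U}$ is a smooth $M$-dimensional manifold, $\pi:\mathcal{Q}\to\mathcal{U}$ is a smooth submersion, and $\Delta_{\mathbf q}=\ker T_{\mathbf q}\pi$ (rank $N$). $\Gamma\subset T\mathcal{Q}$ is a smooth distribution (vector sub-bundle, not necessarily integrable) of rank $N+M-\nu$. Transversality $\Delta_{\mathbf q}+\Gamma_{\mathbf q}=T_{\mathbf q}\mathcal{Q}$ is assumed at all points. $\perp$ denotes $\mathbf g$-orthogonal complement. For a subspace $W\subset T_{\mathbf q}\mathcal{Q}$, $\ker W\subset T^*_{\mathbf q}\mathcal{Q}$ denotes its annihilator. $\mathbf g_{\mathbf q}(\mathbf v)$ also denotes the covector $\mathbf w\mapsto\mathbf g_{\mathbf q}[\mathbf v,\mathbf w]$, with inverse isomorphism $\mathbf g_{\mathbf q}^{-1}:T^*_{\mathbf q}\mathcal{Q}\to T_{\mathbf q}\mathcal{Q}$, and $\mathbf g^{-1}_{\mathbf q}[\mathbf p,\tilde{\mathbf p}]=\mathbf g_{\mathbf q}[\mathbf g_{\mathbf q}^{-1}(\mathbf p),\mathbf g_{\mathbf q}^{-1}(\tilde{\mathbf p})]$ is the dual scalar product. $H(q,p)=\frac12g_q^{-1}[p,p]$. $F=F(t,q,p)$ is a given external force, with values in covectors. Decomposition. $(T_{\mathbf q}\mathcal{Q})_I=\Delta_{\mathbf q}\cap\Gamma_{\mathbf q}$,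 $(T_{\mathbf q}\mathcal{Q})_{II}=\Gamma_{\mathbf q}^\perp$, $(T_{\mathbf q}\mathcal{Q})_{III}=(\Delta_{\mathbf q}\cap\Gamma_{\mathbf q})^\perp\cap\Gamma_{\mathbf q}$; these are mutually orthogonal with direct sum $T_{\mathbf q}\mathcal{Q}$. For $J\in\{I,II,III\}$, $P_J$ is the orthogonal projection onto $(T_{\mathbf q}\mathcal{Q})_J$, and $P_J^*=\mathbf g\circ P_J\circ\mathbf g^{-1}$ acts on covectors, with image $(T^*_{\mathbf q}\mathcal{Q})_J=\mathbf g_{\mathbf q}((T_{\mathbf q}\mathcal{Q})_J)$. $F_I=P_I^*F$. Chart. Fix $\Delta$-adapted local charts $(q^1,\dots,q^{N+M})$ on $\mathcal{Q}$ and $(u^1,\dots,u^M)$ on $\mathcal{U}$, so that $\pi$ is given by $u^\alpha=q^{N+\alpha}$, $\alpha=1,\dots,M$; $(q,p)$ are the natural coordinates on $T^*\mathcal{Q}$, and all objects are identified with their coordinate expressions. Maps. $h=h_q$ is the inverse of the bijection $D\pi:(T_q\mathcal{Q})_{III}\to T_{\pi(q)}\mathcal{U}\cong\mathbb{R}^M$, and $k(v)=g_q(h(v))$. Viewing $P_I^*$ and $g^{-1}=(g^{r,s})$ as $q$-dependent matrices, $$\theta_I[p,\tilde p]=\Big(\frac{\partial P_I^*}{\partial q}\cdot g^{-1}(p)\Big)(\tilde p)-\frac12P_I^*\Big(\frac{\partial g^{-1}}{\partial q}[p,\tilde p]\Big),$$ where $\frac{\partial P_I^*}{\partial q}\cdot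 w$ is the derivative of the matrix $P_I^*$ in the direction $w$ and $\frac{\partial g^{-1}}{\partial q}[p,\tilde p]$ is the covector with components $\frac{\partial g^{r,s}}{\partial q^i}p_r\tilde p_s$. Moreover $\Upsilon[p_I,\dot u]=\theta_I[p_I,k(\dot u)]+\theta_I[k(\dot u),p_I]$ and $\Psi[\dot u,\dot u]=\theta_I[k(\dot u),k(\dot u)]$. All these maps are evaluated at $q=q(t)$.
   Formalization: In the ''if'' direction, (i) and (ii) are shown to imply the nonholonomic equations under the extra hypothesis that the derivative of u is differentiable on the time interval; for u merely C^1 that direction fails, since p need not be differentiable. *)

(* Defs.v *)
(* Everything is written in a Delta-adapted chart of Q, whose domain is an open
   set O of R^(N+M).  Tangent vectors and covectors at q are both ROW vectors
   'rV[R]_n; a covector p takes the value (p *m v^T) 0 0 on a vector v.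
   Linear maps act on the right (v *m A), so that a composition "first A, then
   B" is A *m B.  Subspaces are row spaces of matrices (scope %MS).  The
   matrix g q is (g_(i,j)(q)), and its inverse is (g^(r,s)(q)).              *)
From HB Require Import structures.
From mathcomp Require Import all_boot all_order all_algebra.
From mathcomp Require Import all_classical all_reals all_analysis.

Set Implicit Arguments.
Unset Strict Implicit.
Unset Printing Implicit Defensive.

Import Order.TTheory GRing.Theory Num.Theory.
Import numFieldNormedType.Exports.

Local Open Scope classical_set_scope.
Local Open Scope ring_scope.

(* Derivatives along a time interval I which may contain its endpoints: the
   difference quotient at t is restricted to times of I, so the derivative is
   one-sided at an endpoint belonging to I. *)
Definition has_deriv_on (R : realType) (W : normedModType R) (I : set R)
    (f : R -> W) (t : R) (l : W) : Prop :=
  (fun s => (s - t)^-1 *: (f s - f t)) @ within I t^' --> l.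

Definition deriv_on (R : realType) (W : normedModType R) (I : set R)
    (f : R -> W) (t : R) : W :=
  lim ((fun s => (s - t)^-1 *: (f s - f t)) @ within I t^').

Definition differentiable_on (R : realType) (W : normedModType R) (I : set R)
    (f : R -> W) : Prop :=
  forall t, I t -> has_deriv_on I f t (deriv_on I f t).

Definition C1_on (R : realType) (W : normedModType R) (I : set R)
    (f : R -> W) : Prop :=
  differentiable_on I f /\ {within I, continuous (deriv_on I f)}.

Definition time_interval (R : realType) (I : set R) : Prop :=
  is_interval I /\ exists s t, [/\ I s, I t & s < t].

Fixpoint Ck (R : realType) (V W : normedModType R) (k : nat) (O : set V)
    (f : V -> W) : Prop :=
  match k with
  | 0 => forall x, O x -> {for x, continuous f}
  | k'.+1 => (forall x, O x -> differentiable f x) /\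
             (forall v, Ck k' O (fun x => 'D_v f x))
  end.

Definition smooth (R : realType) (V W : normedModType R) (O : set V)
    (f : V -> W) : Prop := forall k, Ck k O f.

Definition gradient (R : realType) (n : nat) (f : 'rV[R]_n -> R)
    (x : 'rV[R]_n) : 'rV[R]_n := \row_i 'D_(delta_mx 0 i) f x.

(* The metric: g_q[v, w], the covector g_q(v), the vector g_q^{-1}(p), and the
   dual scalar product on covectors. *)
Definition gprod (R : realType) (n : nat) (g : 'rV[R]_n -> 'M[R]_n)
    (q v w : 'rV[R]_n) : R := (v *m g q *m w^T) 0 0.

Definition flat (R : realType) (n : nat) (g : 'rV[R]_n -> 'M[R]_n)
    (q v : 'rV[R]_n) : 'rV[R]_n := v *m g q.

Definition ginv (R : realType) (n : nat) (g : 'rV[R]_n -> 'M[R]_n)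
    (q : 'rV[R]_n) : 'M[R]_n := invmx (g q).

Definition sharp (R : realType) (n : nat) (g : 'rV[R]_n -> 'M[R]_n)
    (q p : 'rV[R]_n) : 'rV[R]_n := p *m ginv g q.

Definition dual_gprod (R : realType) (n : nat) (g : 'rV[R]_n -> 'M[R]_n)
    (q p p' : 'rV[R]_n) : R := gprod g q (sharp g q p) (sharp g q p').

Definition riemannian_metric (R : realType) (n : nat) (O : set 'rV[R]_n)
    (g : 'rV[R]_n -> 'M[R]_n) : Prop :=
  [/\ smooth O g,
      forall q, O q -> (g q)^T = g q &
      forall q v, O q -> v != 0 -> 0 < gprod g q v v].

Definition Hamiltonian (R : realType) (n : nat) (g : 'rV[R]_n -> 'M[R]_n)
    (q p : 'rV[R]_n) : R := 2^-1 * dual_gprod g q p p.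

Definition annihilator (R : realType) (n : nat) (W : 'M[R]_n) : 'M[R]_n :=
  kermx W^T.

Definition orthcompl (R : realType) (n : nat) (g : 'rV[R]_n -> 'M[R]_n)
    (q : 'rV[R]_n) (W : 'M[R]_n) : 'M[R]_n := kermx (g q *m W^T).

Definition orthproj (R : realType) (n : nat) (g : 'rV[R]_n -> 'M[R]_n)
    (q : 'rV[R]_n) (W : 'M[R]_n) : 'M[R]_n := proj_mx W (orthcompl g q W).

(* A rank r distribution: Gamma q is only used through its row space, and
   smoothness means the existence of smooth local frames X_1, ..., X_r. *)
Definition smooth_distribution (R : realType) (n : nat) (O : set 'rV[R]_n)
    (r : nat) (Gamma : 'rV[R]_n -> 'M[R]_n) : Prop :=
  forall q, O q -> \rank (Gamma q) = r /\
    exists (U : set 'rV[R]_n) (X : 'I_r -> 'rV[R]_n -> 'rV[R]_n),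
      [/\ open U, U q, U `<=` O, forall i, smooth U (X i) &
          forall x, U x -> (\matrix_(i < r) X i x :=: Gamma x)%MS].

(* The submersion in the adapted charts: u^alpha = q^(N+alpha). *)
Definition chart_pi (R : realType) (N M : nat) (q : 'rV[R]_(N + M)) :
  'rV[R]_M := \row_alpha q 0 (rshift N alpha).

Definition Dpi (R : realType) (N M : nat) (q : 'rV[R]_(N + M)) :
  'M[R]_(N + M, M) := jacobian (@chart_pi R N M) q.

Definition Delta (R : realType) (N M : nat) (q : 'rV[R]_(N + M)) :
  'M[R]_(N + M) := kermx (Dpi q).

Definition T_I (R : realType) (N M : nat)
    (Gamma : 'rV[R]_(N + M) -> 'M[R]_(N + M)) (q : 'rV[R]_(N + M)) :
  'M[R]_(N + M) := (Delta q :&: Gamma q)%MS.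

Definition T_II (R : realType) (N M : nat)
    (g Gamma : 'rV[R]_(N + M) -> 'M[R]_(N + M)) (q : 'rV[R]_(N + M)) :
  'M[R]_(N + M) := orthcompl g q (Gamma q).

Definition T_III (R : realType) (N M : nat)
    (g Gamma : 'rV[R]_(N + M) -> 'M[R]_(N + M)) (q : 'rV[R]_(N + M)) :
  'M[R]_(N + M) := (orthcompl g q (Delta q :&: Gamma q) :&: Gamma q)%MS.

Definition P_I (R : realType) (N M : nat)
    (g Gamma : 'rV[R]_(N + M) -> 'M[R]_(N + M)) (q : 'rV[R]_(N + M)) :
  'M[R]_(N + M) := orthproj g q (T_I Gamma q).

Definition P_II (R : realType) (N M : nat)
    (g Gamma : 'rV[R]_(N + M) -> 'M[R]_(N + M)) (q : 'rV[R]_(N + M)) :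
  'M[R]_(N + M) := orthproj g q (T_II g Gamma q).

Definition P_III (R : realType) (N M : nat)
    (g Gamma : 'rV[R]_(N + M) -> 'M[R]_(N + M)) (q : 'rV[R]_(N + M)) :
  'M[R]_(N + M) := orthproj g q (T_III g Gamma q).

(* P^* = g o P o g^{-1}, in the right-action convention. *)
Definition costar (R : realType) (n : nat) (g P : 'rV[R]_n -> 'M[R]_n)
    (q : 'rV[R]_n) : 'M[R]_n := ginv g q *m P q *m g q.

(* The inverse of Dpi restricted to T_III (the default 0 is irrelevant, as this
   restriction is bijective under transversality). *)
Definition h_map (R : realType) (N M : nat)
    (g Gamma : 'rV[R]_(N + M) -> 'M[R]_(N + M)) (q : 'rV[R]_(N + M))
    (v : 'rV[R]_M) : 'rV[R]_(N + M) :=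
  xget 0 [set w : 'rV[R]_(N + M) | (w <= T_III g Gamma q)%MS /\
                                   w *m Dpi q = v].

Definition k_map (R : realType) (N M : nat)
    (g Gamma : 'rV[R]_(N + M) -> 'M[R]_(N + M)) (q : 'rV[R]_(N + M))
    (v : 'rV[R]_M) : 'rV[R]_(N + M) := flat g q (h_map g Gamma q v).

Definition theta_I (R : realType) (N M : nat)
    (g Gamma : 'rV[R]_(N + M) -> 'M[R]_(N + M)) (q p p' : 'rV[R]_(N + M)) :
  'rV[R]_(N + M) :=
  p' *m 'D_(sharp g q p) (costar g (P_I g Gamma)) q
  - 2^-1 *: ((\row_i (p *m 'D_(delta_mx 0 i) (ginv g) q *m p'^T) 0 0)
             *m costar g (P_I g Gamma) q).

Definition Upsilon (R : realType) (N M : nat)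
    (g Gamma : 'rV[R]_(N + M) -> 'M[R]_(N + M)) (q p : 'rV[R]_(N + M))
    (v : 'rV[R]_M) : 'rV[R]_(N + M) :=
  theta_I g Gamma q p (k_map g Gamma q v)
  + theta_I g Gamma q (k_map g Gamma q v) p.

Definition Psi (R : realType) (N M : nat)
    (g Gamma : 'rV[R]_(N + M) -> 'M[R]_(N + M)) (q : 'rV[R]_(N + M))
    (v v' : 'rV[R]_M) : 'rV[R]_(N + M) :=
  theta_I g Gamma q (k_map g Gamma q v) (k_map g Gamma q v').

Definition nonholonomic_solution (R : realType) (N M : nat)
    (g Gamma : 'rV[R]_(N + M) -> 'M[R]_(N + M))
    (F : R -> 'rV[R]_(N + M) -> 'rV[R]_(N + M) -> 'rV[R]_(N + M))
    (I : set R) (u : R -> 'rV[R]_M) (q p : R -> 'rV[R]_(N + M)) : Prop :=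
  exists rho : R -> 'rV[R]_(N + M), forall t, I t ->
    [/\ has_deriv_on I q t (gradient (Hamiltonian g (q t)) (p t)),
        has_deriv_on I p t
          (- gradient (fun x => Hamiltonian g x (p t)) (q t)
           + F t (q t) (p t) + rho t),
        chart_pi (q t) = u t,
        (p t <= Gamma (q t) *m g (q t))%MS &
        (rho t <= annihilator (Delta (q t)) + annihilator (Gamma (q t)))%MS].

(* dq and du are meant to be the time derivatives of q and u. *)
Definition reduced_equations (R : realType) (N M : nat)
    (g Gamma : 'rV[R]_(N + M) -> 'M[R]_(N + M))
    (F : R -> 'rV[R]_(N + M) -> 'rV[R]_(N + M) -> 'rV[R]_(N + M))
    (I : set R) (du : R -> 'rV[R]_M) (q dq p : R -> 'rV[R]_(N + M)) : Prop :=
  forall t, I t ->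
    let p_I := p t *m costar g (P_I g Gamma) (q t) in
    let F_I := F t (q t) (p t) *m costar g (P_I g Gamma) (q t) in
    [/\ dq t *m P_II g Gamma (q t) = 0,
        dq t *m P_III g Gamma (q t) = h_map g Gamma (q t) (du t),
        dq t *m P_I g Gamma (q t) = sharp g (q t) p_I &
        has_deriv_on I (fun s => p s *m costar g (P_I g Gamma) (q s)) t
          (theta_I g Gamma (q t) p_I p_I
           + Upsilon g Gamma (q t) p_I (du t)
           + Psi g Gamma (q t) (du t) (du t) + F_I)].

(* Main.v *)
Require Import Defs.
From HB Require Import structures.
From mathcomp Require Import all_boot all_order all_algebra.
From mathcomp Require Import all_classical all_reals all_analysis.

Set Implicit Arguments.
Unset Strict Implicit.
Unset Printing Implicit Defensive.

Import Order.TTheory GRing.Theory Num.Theory.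
Import numFieldNormedType.Exports.

Local Open Scope classical_set_scope.
Local Open Scope ring_scope.

(** The motion is determined by projecting Hamilton's equations.  A velocity
    satisfying the constraint lies in Gamma, so it has no II-component, and its
    III-component is the horizontal lift h(du) of the velocity of the control,
    since T_III is a complement of ker D pi in Gamma.  The only dynamical
    unknown is the I-component of p.  Reactions are the covectors annihilating
    T_I = Delta :&: Gamma ([reaction_sumP]), hence they are exactly what the dual
    projection P_I^* forgets.  By the product rule ([has_deriv_on_costar_I])

      d/dt (p P_I^* ) = theta_I[p, p] + (dp/dt + dH/dq) P_I^*,

    and theta_I[p, p] expands into theta_I, Upsilon and Psi once p is written as
    p_I + k(du) ([theta_split]).  So the reduced equation says precisely that
    dp/dt + dH/dq - F annihilates T_I, i.e. is a reaction.  In the reverse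
    direction pi(q) and u have the same velocity and agree at t_0, so they
    coincide; and p = p_I + k(du) is differentiable because du is.

    All this needs P_I and h to be differentiable in q.  With P the orthogonal
    projection onto Gamma and D = D pi, put S = g^-1 P and K = D^T S D, where a
    vector is a row on which matrices act from the right.  The matrix K is
    invertible by transversality, and

      P_I = g S - g S D K^-1 D^T S,   P_II = 1 - g S,
      P_III = g S D K^-1 D^T S,       h(v) = v K^-1 D^T S

    ([projI], [projII], [projIII], [h_mapE]).  So everything is a rational
    expression in g, D and S, and S is smooth because local frames of Gamma give
    P by the Gram formula ([orthproj_frame], [cometric_exists]). *)

(** * Orthogonal projections for a positive definite matrix *)

Lemma unitmx_inj (F : fieldType) (n : nat) (A : 'M[F]_n) :
  (forall v : 'rV_n, v *m A = 0 -> v = 0) -> A \in unitmx.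
Proof.
move=> injA; rewrite -row_free_unit -kermx_eq0; apply/rowV0P => v.
by move=> /sub_kermxP; exact: injA.
Qed.

Section PositiveDefinite.
Context {F : realFieldType} {n : nat} {G : 'M[F]_n}.
Hypothesis Gsym : G^T = G.
Hypothesis Gpos : forall v : 'rV_n, v != 0 -> 0 < (v *m G *m v^T) 0 0.

Lemma gram_eq0 (m : nat) (A : 'M[F]_(m, n)) : A *m G *m A^T = 0 -> A = 0.
Proof.
move=> A0; apply/row_matrixP => i; rewrite row0; apply/eqP/negPn/negP => /Gpos.
suff -> : (row i A *m G *m (row i A)^T) 0 0 = (A *m G *m A^T) i i.
  by rewrite A0 mxE ltxx.
by rewrite tr_row -row_mul !mxE; apply: eq_bigr => j _; rewrite !mxE.
Qed.

Lemma posdef_unit : G \in unitmx.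
Proof. by apply: unitmx_inj => v vG0; apply: gram_eq0; rewrite vG0 mul0mx. Qed.

Lemma gram_unit (r : nat) (X : 'M[F]_(r, n)) :
  row_free X -> X *m G *m X^T \in unitmx.
Proof.
move=> freeX; apply: unitmx_inj => v vX0; apply: (row_free_inj freeX).
rewrite mul0mx; apply: gram_eq0.
by rewrite trmx_mul mulmxA -!(mulmxA v) mulmxA vX0 mul0mx.
Qed.

Lemma orth_cap0 (W : 'M[F]_n) : (W :&: kermx (G *m W^T) = 0)%MS.
Proof.
apply: gram_eq0; have /submxP[B def] := capmxSl W (kermx (G *m W^T)).
have /sub_kermxP Z0 := capmxSr W (kermx (G *m W^T)).
by rewrite {2}def trmx_mul !mulmxA -(mulmxA _ G) Z0 mul0mx.
Qed.

(** The two hypotheses say that Q maps into W and that id - Q maps into the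
    orthogonal complement; this is how every projection below is identified
    without computing with bases. *)
Lemma orthproj_unique (W Q : 'M[F]_n) : (Q <= W)%MS ->
  (1%:M - Q) *m (G *m W^T) = 0 -> proj_mx W (kermx (G *m W^T)) = Q.
Proof.
move=> QW /sub_kermxP Q1; have := orth_cap0 W; set V := kermx _ => W0.
rewrite -[LHS]mul1mx -(subrK Q 1%:M) mulmxDl.
by rewrite proj_mx_0 // proj_mx_id // add0r.
Qed.

(** A frame makes the projection a rational expression in the metric and the
    frame, which is why it depends smoothly on the point. *)
Lemma orthproj_frame (r : nat) (X : 'M[F]_(r, n)) (W : 'M[F]_n) :
  row_free X -> (X :=: W)%MS -> proj_mx W (kermx (G *m W^T)) =
  G *m X^T *m invmx (X *m G *m X^T) *m X.
Proof.
move=> freeX XW; apply: orthproj_unique; first by rewrite -XW submxMl.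
have /submxP[B ->] : (W <= X)%MS by rewrite XW.
set Gram := X *m G *m X^T; rewrite mulmxBl mul1mx trmx_mul.
have -> : G *m X^T *m invmx Gram *m X *m (G *m (X^T *m B^T)) =
    G *m X^T *m (invmx Gram *m Gram) *m B^T by rewrite /Gram !mulmxA.
by rewrite mulVmx ?gram_unit // mulmx1 !mulmxA subrr.
Qed.

Lemma orthproj_compl (W : 'M[F]_n) :
  (1%:M - proj_mx W (kermx (G *m W^T))) *m (G *m W^T) = 0.
Proof.
set V := kermx _; apply/sub_kermxP; rewrite -/V.
have := @proj_mx_compl_sub _ _ _ W V 1%:M; rewrite mul1mx; apply.
rewrite sub1mx /row_full; have := mxrank_sum_cap W V.
rewrite orth_cap0 mxrank0 addn0 mxrank_ker => ->.
rewrite -(mxrank_tr (G *m _)) trmx_mul trmxK Gsym mxrankMfree.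
  by rewrite subnKC ?eqxx ?rank_leq_row.
by rewrite row_free_unit posdef_unit.
Qed.

End PositiveDefinite.

(** * The three projections in terms of a dual product on constrained covectors *)

Section Decomposition.
Context {F : realFieldType} {n m : nat} {G Gamma : 'M[F]_n} {D : 'M[F]_(n, m)}.
Hypothesis Gsym : G^T = G.
Hypothesis Gpos : forall v : 'rV_n, v != 0 -> 0 < (v *m G *m v^T) 0 0.
Hypothesis D_full : forall v : 'rV_m, v *m D^T = 0 -> v = 0.
Hypothesis transversal : (kermx D + Gamma :=: 1%:M)%MS.
Context {S : 'M[F]_n}.
(* These two properties characterise S = G^-1 P, where P is the orthogonal
   projection onto Gamma. *)
Hypothesis S_sub : (S <= Gamma)%MS.
Hypothesis S_compl : (1%:M - G *m S) *m (G *m Gamma^T) = 0.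

Let Gunit : G \in unitmx := posdef_unit Gpos.
Let orth (W : 'M[F]_n) := kermx (G *m W^T).
Let TI := (kermx D :&: Gamma)%MS.
Let TIII := (orth TI :&: Gamma)%MS.
(* The dual product S pulled back to covectors of the base by the submersion.
   Its inverse is the metric that the horizontal lifts induce on the base. *)
Let K : 'M[F]_m := D^T *m S *m D.

(** G S is the orthogonal projection P onto Gamma.  The symmetry of S amounts to
    that of P G, which holds because P G P^T is symmetric and equal to G P^T. *)
Lemma cometric_sym : S^T = S.
Proof.
have /submxP[B SB] := S_sub.
have PG : G *m (G *m S)^T = G *m S *m G *m (G *m S)^T.
  have ST : S^T = Gamma^T *m B^T by rewrite {1}SB trmx_mul.
  apply/eqP; rewrite -subr_eq0 trmx_mul Gsym ST.
  suff -> : G *m (Gamma^T *m B^T *m G) - G *m S *m G *m (Gamma^T *m B^T *m G) =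
            (1%:M - G *m S) *m (G *m Gamma^T) *m B^T *m G.
    by rewrite S_compl !mul0mx.
  by rewrite !mulmxBl mul1mx !mulmxA.
have : (G *m (G *m S)^T)^T = G *m (G *m S)^T.
  by rewrite PG !trmx_mul !trmxK Gsym !mulmxA.
rewrite !trmx_mul !trmxK Gsym !mulmxA.
move=> /(congr1 (fun A => invmx G *m (A *m invmx G))).
by rewrite !mulmxK // !mulKmx // => ->.
Qed.

Lemma cometric_id (k : nat) (W : 'M[F]_(k, n)) :
  (W <= Gamma)%MS -> W *m G *m S = W.
Proof.
move=> /submxP[B ->]; apply: trmx_inj.
have -> : B *m Gamma *m G *m S = B *m (Gamma *m G *m S) by rewrite !mulmxA.
rewrite !trmx_mul cometric_sym Gsym; congr (_ *m _).
apply/esym/(can_inj (mulKmx Gunit)); apply/eqP; rewrite -subr_eq0; apply/eqP.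
by rewrite -S_compl mulmxBl mul1mx !mulmxA.
Qed.

Lemma cometric_proj : S *m G *m S = S.
Proof. exact: cometric_id S_sub. Qed.

(** Gamma is fixed by G S, so Gamma^T factors through S. *)
Lemma cometric_ker (k : nat) (A : 'M[F]_(k, n)) : A *m S = 0 -> A *m Gamma^T = 0.
Proof.
move=> A0; rewrite -(cometric_id (submx_refl Gamma)).
by rewrite !trmx_mul cometric_sym (mulmxA A) A0 mul0mx.
Qed.

Lemma cometricU_sym : K^T = K.
Proof. by rewrite !trmx_mul trmxK cometric_sym mulmxA. Qed.

(** A covector v of the base in the kernel is null for S, hence its pull-back
    v D^T kills Gamma.  It also kills ker D, and transversality makes it 0. *)
Lemma cometricU_unit : K \in unitmx.
Proof.
apply: unitmx_inj => v vK0; apply: D_full.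
have vS0 : v *m D^T *m S = 0.
  apply: (gram_eq0 Gpos); rewrite !trmx_mul trmxK cometric_sym.
  rewrite !mulmxA -[_ *m S *m G *m S]mulmxA -(mulmxA _ _ (_ *m S)).
  rewrite (mulmxA S) cometric_proj.
  by rewrite -2!(mulmxA v) vK0 mul0mx.
have := cometric_ker vS0; set w := v *m D^T => wGamma.
have wDelta : w *m (kermx D)^T = 0.
  by rewrite -mulmxA -trmx_mul mulmx_ker trmx0 mulmx0.
have : (1%:M <= kermx D + Gamma)%MS by rewrite transversal.
case/sub_addsmxP=> -[a b] /= /(congr1 (fun A => w *m A^T)).
rewrite trmx1 mulmx1 linearD /= (trmx_mul a) (trmx_mul b) mulmxDr.
by rewrite !(mulmxA w) wDelta wGamma !mul0mx addr0.
Qed.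

(** Inside Gamma the subspace ker D is cut out by the columns of D, whose Riesz
    representatives in Gamma are the rows of D^T S; subtracting from G S the
    projection onto these rows leaves the projection onto ker D :&: Gamma. *)
Lemma projI : proj_mx TI (orth TI) =
  G *m S - G *m S *m D *m invmx K *m D^T *m S.
Proof.
apply: (orthproj_unique Gpos).
  rewrite sub_capmx; apply/andP; split.
    apply/sub_kermxP; rewrite mulmxBl -!mulmxA (mulmxA D^T).
    by rewrite mulVmx ?cometricU_unit // mulmx1 subrr.
  rewrite addmx_sub // ?eqmx_opp; exact: submx_trans (submxMl _ _) S_sub.
have /sub_kermxP WD := capmxSl (kermx D) Gamma.
have /cometric_id := capmxSr (kermx D) Gamma.
rewrite -/TI in WD * => /(congr1 trmx); rewrite !trmx_mul cometric_sym Gsym => SW.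
rewrite !mulmxBl mul1mx -!mulmxA SW -trmx_mul WD trmx0 !mulmx0 subr0.
by rewrite subrr.
Qed.

Lemma projII : proj_mx (orth Gamma) (orth (orth Gamma)) = 1%:M - G *m S.
Proof.
apply: (orthproj_unique Gpos); first exact/sub_kermxP.
have : orth Gamma *m (G *m Gamma^T) = 0 by exact/sub_kermxP.
move: (orth Gamma) => W WG.
have WS : W *m (G *m S) = 0.
  have /submxP[B SB] := S_sub.
  by rewrite -cometric_sym SB trmx_mul (mulmxA G) mulmxA WG mul0mx.
move: WS => /(congr1 trmx); rewrite trmx0 !trmx_mul cometric_sym Gsym => SW.
by rewrite subKr -mulmxA (mulmxA S) SW mulmx0.
Qed.

(** A vector of Gamma killed by D lies in ker D :&: Gamma, to which T_III is
    orthogonal. *)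
Lemma lift_unique (k : nat) (W : 'M[F]_(k, n)) :
  (W <= TIII)%MS -> W *m D = 0 -> W = 0.
Proof.
rewrite sub_capmx => /andP[/sub_kermxP WTI WGamma] WD; apply: (gram_eq0 Gpos).
have /submxP[B WB] : (W <= TI)%MS by rewrite sub_capmx WGamma andbT; exact/sub_kermxP.
by rewrite {2}WB trmx_mul -mulmxA (mulmxA G) mulmxA WTI mul0mx.
Qed.

Lemma lift_sub (k : nat) (A : 'M[F]_(k, m)) : (A *m D^T *m S <= TIII)%MS.
Proof.
rewrite sub_capmx; apply/andP; split; last exact: submx_trans (submxMl _ _) S_sub.
have /sub_kermxP WD := capmxSl (kermx D) Gamma.
have /cometric_id WS := capmxSr (kermx D) Gamma.
apply/sub_kermxP; rewrite -/TI in WD WS *; move: TI WD WS => W WD /(congr1 trmx).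
rewrite !trmx_mul cometric_sym Gsym -(mulmxA (A *m D^T)) => ->.
by rewrite -mulmxA -trmx_mul WD trmx0 mulmx0.
Qed.

Lemma lift_section (k : nat) (v : 'M[F]_(k, m)) : v *m invmx K *m D^T *m S *m D = v.
Proof.
have -> : v *m invmx K *m D^T *m S *m D = v *m (invmx K *m K).
  by rewrite /K !mulmxA.
by rewrite mulVmx ?mulmx1 // cometricU_unit.
Qed.

(** K^-1 D^T S inverts D on T_III, so it is the matrix of the horizontal lift. *)
Lemma liftK (k : nat) (W : 'M[F]_(k, n)) :
  (W <= TIII)%MS -> W *m D *m invmx K *m D^T *m S = W.
Proof.
move=> WT; apply/eqP; rewrite -subr_eq0; apply/eqP; apply: lift_unique.
  by rewrite addmx_sub ?eqmx_opp // lift_sub.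
by rewrite mulmxBl lift_section subrr.
Qed.

Lemma projIII : proj_mx TIII (orth TIII) = G *m S *m D *m invmx K *m D^T *m S.
Proof.
apply: (orthproj_unique Gpos); first exact: lift_sub.
have WT := liftK (submx_refl TIII).
have /cometric_id WS := capmxSr (orth TI) Gamma.
rewrite -/TIII in WS; move: TIII WT WS => W WT WS.
move: WS => /(congr1 trmx); rewrite !trmx_mul cometric_sym Gsym => WS.
move: WT => /(congr1 trmx).
rewrite !trmx_mul trmxK trmx_inv cometric_sym cometricU_sym => WT.
by rewrite mulmxBl mul1mx -(mulmxA _ S (G *m _)) WS -{1}WT !mulmxA subrr.
Qed.

(** The sum of the annihilators of ker D and Gamma is the annihilator of their
    intersection, that is, the kernel of the dual of the projection onto it.
    For the converse, rho splits explicitly as (rho - sigma) + sigma, where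
    sigma = rho S D K^-1 D^T factors through D. *)
Lemma annihilator_sumP (rho : 'rV[F]_n) :
  (rho <= kermx (kermx D)^T + kermx Gamma^T)%MS =
  (rho *m (S *m G - S *m D *m invmx K *m D^T *m S *m G) == 0).
Proof.
have factor : S *m G - S *m D *m invmx K *m D^T *m S *m G =
    (S - S *m D *m invmx K *m D^T *m S) *m G by rewrite mulmxBl.
set Z := S - S *m D *m invmx K *m D^T *m S in factor.
apply/idP/eqP => [/sub_addsmxP[[a b] -> /=] | rho0].
  have GammaZ : kermx Gamma^T *m Z = 0.
    have /submxP[B SB] := S_sub.
    have -> : Z = S *m (1%:M - D *m invmx K *m D^T *m S).
      by rewrite mulmxBr mulmx1 !mulmxA.
    by rewrite -{1}cometric_sym SB trmx_mul 2!mulmxA mulmx_ker !mul0mx.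
  have DeltaZ : kermx (kermx D)^T *m Z = 0.
    have /submxP[B /(congr1 trmx)] : (Z^T <= kermx D)%MS.
      have -> : Z^T = Z.
        rewrite /Z raddfB /= !trmx_mul trmxK trmx_inv cometric_sym.
        by rewrite cometricU_sym !mulmxA.
      by apply/sub_kermxP; rewrite mulmxBl lift_section subrr.
    by rewrite trmxK (trmx_mul B) => ->; rewrite mulmxA mulmx_ker mul0mx.
  move: (kermx Gamma^T) (kermx (kermx D)^T) GammaZ DeltaZ => kG kD kGZ kDZ.
  rewrite factor mulmxDl 2!(mulmxA _ Z) -(mulmxA a) -(mulmxA b) kGZ kDZ.
  by rewrite !mulmx0 mul0mx addr0.
have {}rho0 : rho *m S = rho *m S *m D *m invmx K *m D^T *m S.
  apply/eqP; rewrite -subr_eq0; apply/eqP/(can_inj (mulmxK Gunit)).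
  by rewrite mul0mx -rho0 factor mulmxA /Z mulmxBr !mulmxA.
set sigma := rho *m S *m D *m invmx K *m D^T.
rewrite -[rho](subrK sigma) addrC; apply: addmx_sub_adds.
  apply/sub_kermxP; rewrite /sigma -(mulmxA _ D^T) -trmx_mul mulmx_ker trmx0.
  by rewrite mulmx0.
apply/sub_kermxP/cometric_ker; rewrite mulmxBl.
by rewrite -rho0 subrr.
Qed.

End Decomposition.

(** * Differentiable matrix-valued maps *)

Lemma cvg_mxP (R : realType) (T : Type) (F : set_system T) (FF : Filter F)
    (m n : nat) (f : T -> 'M[R]_(m, n)) (l : 'M[R]_(m, n)) :
  f @ F --> l <-> forall i j, f x i j @[x --> F] --> l i j.
Proof.
split=> [fl i j|fl].
  exact: (cvg_comp _ _ fl (@coord_continuous _ _ _ i j l)).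
apply/cvgrPdist_le => /= e e0; near=> x.
rewrite /Num.Def.normr/= mx_normrE (bigmax_le _ (ltW e0))//= => i _.
rewrite !mxE; move: i; near: x; apply: filter_forall => /= i.
exact: ((cvgrPdist_le _ _).1 (fl i.1 i.2)).
Unshelve. all: by end_near. Qed.

Section Differentiability.
Context {R : realType} {V : normedModType R}.

Lemma differentiable_bigsum (T : Type) (W : normedModType R) (r : seq T)
    (f : T -> V -> W) (x : V) :
  (forall i, differentiable (f i) x) ->
  differentiable (fun y => \sum_(i <- r) f i y) x.
Proof.
move=> df; elim: r => [|i r IH].
  under eq_fun do rewrite big_nil.
  exact: differentiable_cst.
under eq_fun do rewrite big_cons.
exact: differentiableD.
Qed.

Lemma differentiable_bigprod (T : Type) (r : seq T) (f : T -> V -> R) (x : V) :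
  (forall i, differentiable (f i) x) ->
  differentiable (fun y => \prod_(i <- r) f i y) x.
Proof.
move=> df; elim: r => [|i r IH].
  under eq_fun do rewrite big_nil.
  exact: differentiable_cst.
under eq_fun do rewrite big_cons.
exact: differentiableM.
Qed.

(** A matrix is a finite sum of its entries times constant matrices, so the
    rules for scalar functions yield those for products, transposes,
    determinants and inverses. *)
Lemma differentiable_mxP (m n : nat) (f : V -> 'M[R]_(m, n)) (x : V) :
  differentiable f x <-> forall i j, differentiable (fun y => f y i j) x.
Proof.
split=> [df i j|df].
  apply: (@differentiable_comp _ _ _ _ f (fun A => A i j)) => //.
  exact: differentiable_coord.
rewrite (_ : f = fun y => \sum_i \sum_j f y i j *: delta_mx i j).
  apply: differentiable_bigsum => i; apply: differentiable_bigsum => j.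
  exact: differentiableZl.
by apply/funext => y; exact: matrix_sum_delta.
Qed.

Lemma differentiable_trmx (m n : nat) (f : V -> 'M[R]_(m, n)) (x : V) :
  differentiable f x -> differentiable (fun y => (f y)^T) x.
Proof.
move=> /differentiable_mxP df; apply/differentiable_mxP => i j.
by under eq_fun do rewrite mxE.
Qed.

Lemma differentiable_det (n : nat) (f : V -> 'M[R]_n) (x : V) :
  differentiable f x -> differentiable (fun y => \det (f y)) x.
Proof.
move=> /differentiable_mxP df; apply: differentiable_bigsum => s.
apply: (@differentiableM _ _ (cst _)); first exact: differentiable_cst.
exact: differentiable_bigprod.
Qed.

Lemma differentiable_mulmx (m n k : nat) (f : V -> 'M[R]_(m, n))
    (g : V -> 'M[R]_(n, k)) (x : V) :
  differentiable f x -> differentiable g x ->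
  differentiable (fun y => f y *m g y) x.
Proof.
move=> /differentiable_mxP df /differentiable_mxP dg.
apply/differentiable_mxP => i j; under eq_fun do rewrite mxE.
by apply: differentiable_bigsum => l; exact: differentiableM.
Qed.

Lemma differentiable_near_eq (W : normedModType R) (f h : V -> W) (x : V) :
  (\near x, f x = h x) -> differentiable f x -> differentiable h x.
Proof.
move=> fh df; have [dfc /eqaddoP fE] := (diff_locallyP _ _).1 df.
have fhx := nbhs_singleton fh.
have hE : h \o shift x = cst (h x) + 'd f x +o_ (0 : V) id.
  apply/eqaddoP => e e0; move: fh (fE e e0); rewrite (near_shift 0) => fh'.
  apply: filterS2 fh' => y /=; rewrite subr0 !fctE /= => fhy.
  by rewrite fhy fhx.
by apply/diff_locallyP; rewrite (diff_unique dfc hE).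
Qed.

Lemma differentiable_invmx (n : nat) (f : V -> 'M[R]_n) (x : V) :
  differentiable f x -> f x \in unitmx -> differentiable (fun y => invmx (f y)) x.
Proof.
move=> df fx; have ddet := differentiable_det df.
have fx0 : \det (f x) != 0 by rewrite -unitfE.
apply: (@differentiable_near_eq _ (fun y => (\det (f y))^-1 *: \adj (f y))).
  (* Near x the determinant stays nonzero, so the cofactor formula applies. *)
  have det0 : \forall y \near x, \det (f y) != 0.
    have /(_ [set z | z != 0]) := differentiable_continuous ddet; apply.
    exact: open_nbhs_nbhs (conj (@open_neq _ 0) fx0).
  near=> y; rewrite /invmx unitmxE unitfE ifT //; near: y; exact: det0.
apply/differentiable_mxP => i j; under eq_fun do rewrite !mxE.
apply: differentiableM; first exact: differentiableV.
apply: differentiableM; first exact: differentiable_cst.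
apply: differentiable_det; apply/differentiable_mxP => a b.
under eq_fun do rewrite !mxE.
by move/differentiable_mxP: df.
Unshelve. all: by end_near. Qed.

End Differentiability.

Lemma mulmx_continuous (R : realType) (m n k : nat) :
  continuous (fun x : 'M[R]_(m, n) * 'M[R]_(n, k) => x.1 *m x.2).
Proof.
move=> x; apply: differentiable_continuous; apply: differentiable_mulmx.
  by apply: linear_differentiable => z; exact: cvg_fst.
by apply: linear_differentiable => z; exact: cvg_snd.
Qed.

(** * Derivatives relative to a time interval *)

Section TimeDerivative.
Context {R : realType} (I : set R).

Lemma within_dnbhs_neq (t : R) : \forall s \near within I t^', s != t.
Proof.
rewrite near_withinE; near=> s => _; near: s; exact: nbhs_dnbhs_neq.
Unshelve. all: by end_near. Qed.

Lemma has_deriv_on_cvg (W : normedModType R) (f : R -> W) (t : R) (l : W) :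
  has_deriv_on I f t l -> f s @[s --> within I t^'] --> f t.
Proof.
move=> fl.
have idt : s @[s --> within I t^'] --> t.
  by apply: cvg_trans (@nbhs_dnbhs _ t); exact: cvg_within.
have : f t + (s - t) *: ((s - t)^-1 *: (f s - f t)) @[s --> within I t^']
    --> f t + (t - t) *: l.
  apply: cvgD; first exact: cvg_cst.
  by apply: cvgZ => //; apply: cvgB => //; exact: cvg_cst.
rewrite subrr scale0r addr0; apply: cvg_trans; apply: near_eq_cvg; near=> s.
have st : s - t != 0 by rewrite subr_eq0; near: s; exact: within_dnbhs_neq.
by rewrite scalerA mulfV // scale1r addrC subrK.
Unshelve. all: by end_near. Qed.

Lemma has_deriv_on_near_eq (W : normedModType R) (f h : R -> W) (t : R) (l : W) :
  (\forall s \near within I t^', f s = h s) -> f t = h t ->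
  has_deriv_on I f t l -> has_deriv_on I h t l.
Proof.
move=> fh fht; apply: cvg_trans; apply: near_eq_cvg; near=> s.
by rewrite fht (near fh s).
Unshelve. all: by end_near. Qed.

Lemma has_deriv_on_eq (W : normedModType R) (f h : R -> W) (t : R) (l : W) :
  (forall s, I s -> f s = h s) -> I t ->
  has_deriv_on I f t l -> has_deriv_on I h t l.
Proof.
move=> fh It; apply: has_deriv_on_near_eq; last exact: fh.
by rewrite near_withinE; near=> s; exact: fh.
Unshelve. all: by end_near. Qed.

Lemma has_deriv_onD (W : normedModType R) (f h : R -> W) (t : R) (l k : W) :
  has_deriv_on I f t l -> has_deriv_on I h t k ->
  has_deriv_on I (fun s => f s + h s) t (l + k).
Proof.
move=> fl hk; apply: cvg_trans (cvgD fl hk); apply: near_eq_cvg; near=> s.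
by rewrite !fctE -scalerDr opprD addrACA.
Unshelve. all: by end_near. Qed.

Lemma has_deriv_onZ (W : normedModType R) (k : R) (f : R -> W) (t : R) (l : W) :
  has_deriv_on I f t l -> has_deriv_on I (fun s => k *: f s) t (k *: l).
Proof.
move=> fl; apply: cvg_trans (cvgZ (cvg_cst k) fl); apply: near_eq_cvg; near=> s.
by rewrite -scalerBr !scalerA mulrC.
Unshelve. all: by end_near. Qed.

Lemma has_deriv_on_entry (m n : nat) (f : R -> 'M[R]_(m, n)) (t : R)
    (l : 'M[R]_(m, n)) (i : 'I_m) (j : 'I_n) :
  has_deriv_on I f t l -> has_deriv_on I (fun s => f s i j : R) t (l i j).
Proof.
move=> /cvg_mxP /(_ i j); apply: cvg_trans; apply: near_eq_cvg; near=> s.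
by rewrite !mxE.
Unshelve. all: by end_near. Qed.

Lemma has_deriv_on_pair (V W : normedModType R) (f : R -> V) (h : R -> W)
    (t : R) (l : V) (k : W) :
  has_deriv_on I f t l -> has_deriv_on I h t k ->
  has_deriv_on I (fun s => (f s, h s)) t (l, k).
Proof. by move=> fl hk; exact: cvg_pair fl hk. Qed.

(** Chain rule for an outer map that is Frechet differentiable.  The increment
    of the inner path tends to 0 like s - t, so the remainder of the outer map
    is negligible after division by s - t, also for one-sided limits. *)
Lemma has_deriv_on_comp (V W : normedModType R) (f : V -> W) (c : R -> V)
    (t : R) (l : V) :
  differentiable f (c t) -> has_deriv_on I c t l ->
  has_deriv_on I (f \o c) t ('d f (c t) l).
Proof.
move=> df cl; have [dfc /eqaddoP fE] := (diff_locallyP _ _).1 df.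
have c0 : c s - c t @[s --> within I t^'] --> (0 : V).
  rewrite -(subrr (c t)); apply: cvgB; last exact: cvg_cst.
  exact: has_deriv_on_cvg cl.
pose rem (h : V) := f (h + c t) - (f (c t) + 'd f (c t) h).
have rem0 : (s - t)^-1 *: rem (c s - c t) @[s --> within I t^'] --> (0 : W).
  apply/cvgr0Pnorm_le => e e0.
  (* The difference quotients of c converge to l, so they are eventually
     bounded by |l| + 1. *)
  have M0 : 0 < `|l| + 1 by rewrite ltr_wpDl.
  have remh := fE (e / (`|l| + 1)) (divr_gt0 e0 M0).
  have := c0 _ remh; rewrite nbhs_simpl /= => remc.
  have normc : \forall s \near within I t^', `|(s - t)^-1 *: (c s - c t)| <= `|l| + 1.
    by apply: cvgr_norm_le cl _ _; rewrite ltrDl.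
  near=> s.
  rewrite normrZ.
  apply: (@le_trans _ _ (`|(s - t)^-1| * (e / (`|l| + 1) * `|c s - c t|))).
    by apply: ler_wpM2l => //; exact: (near remc s).
  rewrite mulrCA -normrZ -ler_pdivlMl ?divr_gt0 // invf_div divfK ?gt_eqF //.
  exact: (near normc s).
rewrite /has_deriv_on -[X in _ --> X]addr0.
have lin : 'd f (c t) ((s - t)^-1 *: (c s - c t)) @[s --> within I t^']
    --> 'd f (c t) l.
  exact: (cvg_comp _ _ cl (dfc l)).
apply: cvg_trans (cvgD lin rem0); apply: near_eq_cvg; near=> s.
rewrite !fctE /= linearZ /= -scalerDr /rem subrK; congr (_ *: _).
by rewrite addrC opprD addrA subrK.
Unshelve. all: by end_near. Qed.

Lemma has_deriv_on_mulmx (m n k : nat) (A : R -> 'M[R]_(m, n))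
    (B : R -> 'M[R]_(n, k)) (t : R) (A' : 'M[R]_(m, n)) (B' : 'M[R]_(n, k)) :
  has_deriv_on I A t A' -> has_deriv_on I B t B' ->
  has_deriv_on I (fun s => A s *m B s) t (A' *m B t + A t *m B').
Proof.
move=> dA dB.
have bilin : differentiable
    (fun x : 'M[R]_(m, n) * 'M[R]_(n, k) => x.1 *m x.2) (A t, B t).
  exact/differentiable_bilin/mulmx_continuous.
have := has_deriv_on_comp bilin (has_deriv_on_pair dA dB).
rewrite diff_bilin; last exact: mulmx_continuous.
by rewrite /= addrC.
Qed.

Hypothesis I_itv : time_interval I.

(** Every point of a nondegenerate interval is an accumulation point of it: the
    witness s moves from t by a small step towards another point r of I.
    This is what makes one-sided derivatives unique. *)
Lemma within_proper (t : R) : I t -> ProperFilter (within I t^').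
Proof.
move=> It; have [itvI [a [b [Ia Ib ab]]]] := I_itv.
have [r rt Ir] : exists2 r, r != t & I r.
  have [at_|] := eqVneq a t; last by exists a.
  by exists b; rewrite // -at_ gt_eqF.
apply: Build_ProperFilter_ex => P; rewrite /within/= => -[e /= e0 eP].
pose d := Num.min (e / 2) `|r - t|; pose s := t + Num.sg (r - t) * d.
have d0 : 0 < d by rewrite lt_min divr_gt0 //= normr_gt0 subr_eq0.
have st : s != t.
  by rewrite -subr_eq0 addrAC subrr add0r mulf_eq0 sgr_eq0 subr_eq0 negb_or rt gt_eqF.
exists s; apply: eP => //=.
  rewrite /ball_ /= opprD addNKr normrN normrM normr_sg subr_eq0 rt mul1r.
  by rewrite gtr0_norm // gt_min ltr_pdivrMr // ltr_pMr // ltr1n.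
have [rt0|rt0] := ltP r t.
  apply: (itvI r t) => //; rewrite /s ltr0_sg ?subr_lt0 // mulN1r.
  rewrite lerBrDl gerBl (ltW d0) andbT.
  have : d <= `|r - t| by rewrite ge_min lexx orbT.
  by rewrite ltr0_norm ?subr_lt0 // opprB lerBrDr.
have rt1 : t < r by rewrite lt_neqAle eq_sym rt.
apply: (itvI t r) => //; rewrite /s gtr0_sg ?subr_gt0 // mul1r.
rewrite lerDl (ltW d0) /=.
have : d <= `|r - t| by rewrite ge_min lexx orbT.
by rewrite gtr0_norm ?subr_gt0 // lerBrDl.
Qed.

Lemma has_deriv_on_unique (W : normedModType R) (f : R -> W) (t : R) (l l' : W) :
  I t -> has_deriv_on I f t l -> has_deriv_on I f t l' -> l = l'.
Proof.
move=> It; have ? := within_proper It.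
exact: (cvg_unique (@norm_hausdorff _ W)).
Qed.

Lemma deriv_on_eq (W : normedModType R) (f : R -> W) (t : R) (l : W) :
  I t -> has_deriv_on I f t l -> deriv_on I f t = l.
Proof.
move=> It; have ? := within_proper It.
exact: (cvg_lim (@norm_hausdorff _ W)).
Qed.

(** Interior times of I see two-sided derivatives, so the mean value theorem
    applies; endpoints only require continuity. *)
Lemma has_deriv_on0_cst (f : R -> R) :
  (forall t, I t -> has_deriv_on I f t 0) ->
  forall s t, I s -> I t -> f s = f t.
Proof.
move=> df.
wlog lt_st : / forall s t, s < t -> I s -> I t -> f s = f t.
  apply=> s t st Is It; have [itvI _] := I_itv.
  have stI x : s <= x <= t -> I x by exact: itvI.
  have dst (x : R) : x \in `]s, t[%R -> is_derive x 1 f 0.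
    rewrite in_itv /= => /andP[sx xt].
    suff lim0 : h^-1 *: ((f \o shift x) (h *: (1 : R)) - f x) @[h --> 0^'] --> (0 : R).
      by apply: DeriveDef; [apply/cvg_ex; exists 0 | exact/cvg_lim].
    have Ix : I x by apply: stI; rewrite !ltW.
    apply/cvgrPdist_le => e e0; have /cvgrPdist_le/(_ e e0) := df x Ix.
    rewrite /within /= => -[d /= d0 xd].
    near=> h.
    have h0 : h != 0 by near: h; exact: nbhs_dnbhs_neq.
    have := xd (h + x); rewrite /ball_ /= opprD addrC subrK normrN addrK.
    rewrite /shift /= [h *: _]mulr1; apply.
    - by near: h; exact: dnbhs0_lt.
    - by rewrite -subr_eq0 addrK.
    - apply: stI; apply/andP; split.
        rewrite -lerBlDr -lerN2 opprB (le_trans (ler_norm _)) // normrN.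
        by near: h; apply: dnbhs0_le; rewrite subr_gt0.
      rewrite -lerBrDr (le_trans (ler_norm _)) //.
      by near: h; apply: dnbhs0_le; rewrite subr_gt0.
  have cst : {within `[s, t], continuous f}.
    apply/subspace_continuousP => x; rewrite /= in_itv /= => /stI Ix.
    have /cvgrPdist_le fx := has_deriv_on_cvg (df x Ix).
    apply/cvgrPdist_le => e e0; have := fx e e0.
    rewrite !near_withinE; apply: filterS => y yP; rewrite /= in_itv /= => /stI Iy.
    have [->|yx] := eqVneq y x; first by rewrite subrr normr0 ltW.
    exact: yP.
  have [c _] := MVT st dst cst.
  by rewrite mul0r => /eqP; rewrite subr_eq0 => /eqP.
move=> s t Is It; have [st|ts|->//] := ltgtP s t; first exact: lt_st.
by apply/esym; exact: lt_st.
Unshelve. all: by end_near. Qed.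

End TimeDerivative.

(** * Directional derivatives as derivatives along lines *)

Section Line.
Context {R : realType} {V W : normedModType R}.

Lemma has_deriv_on_cst (U : normedModType R) (I : set R) (a : U) (t : R) :
  has_deriv_on I (fun=> a) t 0.
Proof.
rewrite /has_deriv_on; under eq_fun do rewrite subrr scaler0.
exact: cvg_cst.
Qed.

Lemma has_deriv_on_line (I : set R) (v x : V) (t : R) :
  has_deriv_on I (fun s => s *: v + x) t v.
Proof.
suff : (fun s => (s - t)^-1 *: (s *: v + x - (t *: v + x))) @ within I t^' --> v by [].
apply: cvg_near_cst; near=> s; apply/eqP.
have st : s - t != 0 by rewrite subr_eq0; near: s; exact: within_dnbhs_neq.
by rewrite opprD addrACA subrr addr0 -scalerBl scalerA mulVf // scale1r.
Unshelve. all: by end_near. Qed.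

(** Together with the converse below, this transfers the product rule for paths
    to directional derivatives. *)
Lemma derive_line (f : V -> W) (x v : V) (l : W) :
  has_deriv_on [set: R] (fun s => f (s *: v + x)) 0 l -> 'D_v f x = l.
Proof.
rewrite /has_deriv_on withinET => fl.
apply/cvg_lim => //; apply: cvg_trans fl; apply: near_eq_cvg; near=> s.
by rewrite /= subr0 scale0r add0r.
Unshelve. all: by end_near. Qed.

Lemma has_deriv_on_along (f : V -> W) (x v : V) : differentiable f x ->
  has_deriv_on [set: R] (fun s => f (s *: v + x)) 0 ('D_v f x).
Proof.
move=> df; rewrite deriveE //.
have x0 : 0 *: v + x = x by rewrite scale0r add0r.
have := @has_deriv_on_comp _ setT _ _ f (fun s => s *: v + x) 0 v.
by rewrite x0; apply => //; exact: has_deriv_on_line.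
Qed.

End Line.

(** * The submersion in adapted charts *)

Section Chart.
Context {R : realType} {N M : nat}.
Implicit Types x w : 'rV[R]_(N + M).

Lemma chart_piE : @chart_pi R N M = rsubmx.
Proof. by apply/funext => x; apply/rowP => j; rewrite !mxE. Qed.

Lemma mul_Dpi x w : w *m Dpi x = chart_pi w.
Proof.
rewrite /Dpi /jacobian mul_rV_lin1 chart_piE.
by rewrite (diff_lin _ (@continuous_rsubmx _ _ _ _)).
Qed.

Lemma Dpi_cst x : Dpi x = lin1_mx rsubmx.
Proof.
apply/row_matrixP => i; transitivity (chart_pi (delta_mx 0 i : 'rV[R]_(N + M))).
  by rewrite rowE mul_Dpi.
by rewrite chart_piE rowE mul_rV_lin1.
Qed.

Lemma Dpi_full x (v : 'rV[R]_M) : v *m (Dpi x)^T = 0 -> v = 0.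
Proof.
move=> vD; have : row_mx (0 : 'M[R]_(M, N)) 1%:M *m Dpi x = 1%:M.
  apply/row_matrixP => i; rewrite row_mul mul_Dpi chart_piE row_row_mx row_mxKr.
  by [].
move=> /(congr1 (fun A => v *m A^T)); rewrite trmx1 mulmx1 => <-.
by rewrite trmx_mul mulmxA vD mul0mx.
Qed.

End Chart.

(** * Differentiability of the dual product of the constraint *)

(** The first two clauses force S x = g^-1 o P, with P the orthogonal projection
    onto the row space of Gamma x: the dual scalar product of covectors
    restricted to Gamma x.  The last one is what makes all the objects of the
    theorem differentiable. *)
Definition is_cometric (R : realType) (n : nat) (O : set 'rV[R]_n)
    (g Gamma S : 'rV[R]_n -> 'M[R]_n) : Prop :=
  forall x, O x ->
    [/\ (S x <= Gamma x)%MS,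
        (1%:M - g x *m S x) *m (g x *m (Gamma x)^T) = 0 &
        differentiable S x].

(** The orthogonal projection is defined pointwise, but near any point it is
    given by the Gram formula of a smooth local frame. *)
Lemma cometric_exists (R : realType) (n r : nat) (O : set 'rV[R]_n)
    (g Gamma : 'rV[R]_n -> 'M[R]_n) :
  open O -> riemannian_metric O g -> smooth_distribution O r Gamma ->
  exists S, is_cometric O g Gamma S.
Proof.
move=> O_open [g_smooth g_sym g_pos] Gamma_distr.
have g_pos' x (Ox : O x) (v : 'rV[R]_n) (v0 : v != 0) : 0 < (v *m g x *m v^T) 0 0.
  exact: g_pos.
have g_unit x (Ox : O x) : g x \in unitmx := posdef_unit (g_pos' x Ox).
have g_diff x (Ox : O x) : differentiable g x := (g_smooth 1%N).1 x Ox.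
exists (fun x => invmx (g x) *m orthproj g x (Gamma x)) => x Ox; split.
- exact: proj_mx_sub.
- rewrite mulKVmx ?g_unit //.
  by apply: orthproj_compl; [exact: g_sym | exact: g_pos'].
apply: differentiable_mulmx.
  by apply: differentiable_invmx; [exact: g_diff | exact: g_unit].
have [_ [U [X [U_open Ux UO X_smooth XGamma]]]] := Gamma_distr x Ox.
pose frame y : 'M[R]_(r, n) := \matrix_(i < r) X i y.
have frame_free y (Uy : U y) : row_free (frame y).
  by rewrite /row_free (XGamma y Uy) (Gamma_distr y (UO y Uy)).1.
have frame_diff : differentiable frame x.
  apply/differentiable_mxP => i j; under eq_fun do rewrite mxE.
  by have /differentiable_mxP := (X_smooth i 1%N).1 x Ux.
apply: (@differentiable_near_eq _ _ _ (fun y =>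
    g y *m (frame y)^T *m invmx (frame y *m g y *m (frame y)^T) *m frame y)).
  near=> y; have Uy : U y by near: y; exact: open_nbhs_nbhs.
  apply/esym/(orthproj_frame (g_pos' y (UO y Uy)) (frame_free y Uy)).
  exact: XGamma.
have gx := g_diff x Ox; have frameT := differentiable_trmx frame_diff.
apply: differentiable_mulmx => //; apply: differentiable_mulmx.
  exact: differentiable_mulmx.
apply: differentiable_invmx.
  by do 2![apply: differentiable_mulmx => //].
by apply: gram_unit; [exact: g_pos' | exact: frame_free].
Unshelve. all: by end_near. Qed.

(** * Geometry at a point of the chart *)

Section Geometry.
Context {R : realType} {N M : nat}.
Context {O : set 'rV[R]_(N + M)} (O_open : open O).
Context {g Gamma S : 'rV[R]_(N + M) -> 'M[R]_(N + M)}.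
Hypothesis g_metric : riemannian_metric O g.
Hypothesis S_cometric : is_cometric O g Gamma S.
Hypothesis transversality : forall x, O x -> (Delta x + Gamma x :=: 1%:M)%MS.

Implicit Types (x v w p : 'rV[R]_(N + M)) (a : 'rV[R]_M).

Let g_sym x : O x -> (g x)^T = g x.
Proof. by case: g_metric => _ + _; apply. Qed.
Let g_pos x : O x -> forall v : 'rV_(N + M), v != 0 -> 0 < (v *m g x *m v^T) 0 0.
Proof. by move=> Ox v; case: g_metric => _ _; apply. Qed.
Let g_unit x : O x -> g x \in unitmx.
Proof. by move=> Ox; exact: posdef_unit (g_pos Ox). Qed.
Let g_diff x : O x -> differentiable g x.
Proof. by move=> Ox; case: g_metric => /(_ 1%N)[+ _] _ _; apply. Qed.

Let S_sub x : O x -> (S x <= Gamma x)%MS.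
Proof. by move=> Ox; case: (S_cometric Ox). Qed.
Let S_compl x : O x -> (1%:M - g x *m S x) *m (g x *m (Gamma x)^T) = 0.
Proof. by move=> Ox; case: (S_cometric Ox). Qed.
Let S_diff x : O x -> differentiable S x.
Proof. by move=> Ox; case: (S_cometric Ox). Qed.

(** The matrix of the horizontal lift h. *)
Definition lift_mx x :=
  invmx ((Dpi x)^T *m S x *m Dpi x) *m (Dpi x)^T *m S x.
Local Notation L := lift_mx.

Section Point.
Context {x : 'rV[R]_(N + M)}.
Hypothesis Ox : O x.

Ltac pointwise lem :=
  (apply: (lem _ _ _ (g x) (Gamma x) (Dpi x))
   || apply: (lem _ _ (g x) (Gamma x)));
  first [exact: g_sym | exact: g_pos | exact: Dpi_full | exact: transversality
        | exact: S_sub | exact: S_compl | idtac].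

Lemma constraint_fixed (k : nat) (W : 'M[R]_(k, N + M)) :
  (W <= Gamma x)%MS -> W *m g x *m S x = W.
Proof. by pointwise @cometric_id. Qed.

Lemma cometricU_inv : (Dpi x)^T *m S x *m Dpi x \in unitmx.
Proof. by pointwise @cometricU_unit. Qed.

Lemma P_IE : P_I g Gamma x = g x *m S x - g x *m S x *m Dpi x *m L x.
Proof. by rewrite /L !mulmxA /P_I /orthproj /orthcompl; pointwise @projI. Qed.

Lemma P_IIE : P_II g Gamma x = 1%:M - g x *m S x.
Proof. by rewrite /P_II /orthproj /T_II /orthcompl; pointwise @projII. Qed.

Lemma P_IIIE : P_III g Gamma x = g x *m S x *m Dpi x *m L x.
Proof. by rewrite /L !mulmxA /P_III /orthproj /T_III /orthcompl; pointwise @projIII. Qed.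

Lemma lift_mx_Dpi : L x *m Dpi x = 1%:M.
Proof.
rewrite /L -[invmx _]mul1mx.
by pointwise @lift_section.
Qed.

Lemma h_mapE a : h_map g Gamma x a = a *m L x.
Proof.
rewrite /h_map; apply: xget_unique.
  split; last by rewrite -mulmxA lift_mx_Dpi mulmx1.
  by rewrite /L !mulmxA; pointwise @lift_sub.
move=> w [wT wD]; apply/eqP; rewrite -subr_eq0; apply/eqP.
pointwise @lift_unique.
  rewrite addmx_sub ?eqmx_opp //.
  by rewrite /L !mulmxA; pointwise @lift_sub.
by rewrite mulmxBl wD -mulmxA lift_mx_Dpi mulmx1 subrr.
Qed.

Lemma costar_IE :
  costar g (P_I g Gamma) x = S x *m g x - S x *m Dpi x *m L x *m g x.
Proof.
rewrite /costar P_IE /ginv mulmxBr mulmxBl !mulmxA mulVmx ?g_unit //.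
by rewrite mul1mx.
Qed.

(** A reaction force satisfies d'Alembert's principle exactly when its I-component
    vanishes; this is why projecting the equations loses no information. *)
Lemma reaction_sumP (rho : 'rV[R]_(N + M)) :
  (rho <= annihilator (Delta x) + annihilator (Gamma x))%MS =
  (rho *m costar g (P_I g Gamma) x == 0).
Proof. by rewrite costar_IE /L !mulmxA; pointwise @annihilator_sumP. Qed.

End Point.
Lemma Dpi_diff x : differentiable (@Dpi R N M) x.
Proof.
rewrite (_ : @Dpi R N M = cst (lin1_mx rsubmx)); first exact: differentiable_cst.
by apply/funext => y; exact: Dpi_cst.
Qed.

Lemma lift_mx_diff x : O x -> differentiable L x.
Proof.
move=> Ox; have dS := S_diff Ox; have dD := Dpi_diff x.
have dDT := differentiable_trmx dD.
apply: differentiable_mulmx => //; apply: differentiable_mulmx => //.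
apply: differentiable_invmx; last exact: cometricU_inv.
by do 2![apply: differentiable_mulmx => //].
Qed.

(** The definition of P_I intersects subspaces at each point separately; only
    its expression through S, valid near x, shows its dependence on x. *)
Lemma costar_I_diff x : O x -> differentiable (costar g (P_I g Gamma)) x.
Proof.
move=> Ox; apply: (@differentiable_near_eq _ _ _ (fun y =>
    S y *m g y - S y *m Dpi y *m L y *m g y)).
  near=> y; have Oy : O y by near: y; exact: open_nbhs_nbhs.
  by rewrite costar_IE.
have dS := S_diff Ox; have dD := Dpi_diff x; have dg := g_diff Ox.
have dL := lift_mx_diff Ox.
apply: differentiableB; first exact: differentiable_mulmx.
by do 3![apply: differentiable_mulmx => //].
Unshelve. all: by end_near. Qed.

Lemma ginv_diff x : O x -> differentiable (ginv g) x.
Proof. by move=> Ox; apply: differentiable_invmx; [exact: g_diff | exact: g_unit]. Qed.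

Lemma HamiltonianE x p : O x ->
  Hamiltonian g x p = 2^-1 * (p *m ginv g x *m p^T) 0 0.
Proof.
move=> Ox; rewrite /Hamiltonian /dual_gprod /gprod /sharp trmx_mul.
rewrite /ginv mulmxKV ?g_unit //.
by rewrite trmx_inv g_sym // mulmxA.
Qed.

Lemma gradient_Hamiltonian_p x p : O x ->
  gradient (Hamiltonian g x) p = sharp g x p.
Proof.
move=> Ox; apply/rowP => i; rewrite mxE; set e := delta_mx 0 i.
have ginvT : (ginv g x)^T = ginv g x by rewrite /ginv trmx_inv g_sym.
apply: derive_line.
(* Transposing the moving argument gives a line again, so the product rule
   handles both occurrences of p. *)
rewrite (_ : (fun _ => _) = fun s =>
    2^-1 *: (((s *: e + p) *m ginv g x *m (s *: e^T + p^T)) 0 0 : R)); last first.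
  by apply/funext => s; rewrite HamiltonianE // linearD linearZ.
have -> : sharp g x p 0 i =
    2^-1 *: ((e *m ginv g x *m p^T + p *m ginv g x *m e^T) 0 0 : R).
  have -> : e *m ginv g x *m p^T = (p *m ginv g x *m e^T)^T.
    by rewrite !trmx_mul trmxK ginvT mulmxA.
  rewrite /sharp; set y := p *m ginv g x.
  have -> : (y *m e^T) = (y 0 i)%:M.
    by apply/matrixP => a b; rewrite !ord1 /e trmx_delta -colE !mxE eqxx mulr1n.
  rewrite tr_scalar_mx; move: (y 0 i) => z; rewrite !mxE eqxx mulr1n.
  by rewrite scalerDr /GRing.scale /= mulrC -splitr.
apply/has_deriv_onZ/has_deriv_on_entry.
have dline := @has_deriv_on_line _ _ setT e p 0.
have dlineT := @has_deriv_on_line _ _ setT e^T p^T 0.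
have dA := has_deriv_on_cst setT (ginv g x) 0.
have := has_deriv_on_mulmx (has_deriv_on_mulmx dline dA) dlineT.
by rewrite mulmx0 !scale0r !add0r addr0.
Qed.

Lemma gradient_Hamiltonian_q x p : O x ->
  gradient (fun y => Hamiltonian g y p) x =
  2^-1 *: \row_i (p *m 'D_(delta_mx 0 i) (ginv g) x *m p^T) 0 0.
Proof.
move=> Ox; apply/rowP => i; rewrite mxE [RHS]mxE [X in _ * X]mxE; set e := delta_mx 0 i.
transitivity ('D_e (fun y => 2^-1 *: ((p *m ginv g y *m p^T) 0 0 : R)) x).
  apply: near_eq_derive; near=> y; apply: HamiltonianE.
  by near: y; exact: open_nbhs_nbhs.
apply/derive_line/has_deriv_onZ.
apply: (@has_deriv_on_entry _ _ _ _ (fun s => p *m ginv g (s *: e + x) *m p^T)).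
have dp := has_deriv_on_cst setT p 0; have dpT := has_deriv_on_cst setT p^T 0.
have := has_deriv_on_mulmx (has_deriv_on_mulmx dp
  (has_deriv_on_along (v := e) (ginv_diff Ox))) dpT.
by rewrite mulmx0 mul0mx add0r addr0.
Unshelve. all: by end_near. Qed.

(** theta_I is bilinear: its derivative term is linear in the direction because
    the dual projection is Frechet differentiable. *)
Lemma theta_ID x (a b : 'rV[R]_(N + M)) : O x ->
  theta_I g Gamma x (a + b) (a + b) =
  theta_I g Gamma x a a +
    (theta_I g Gamma x a b + theta_I g Gamma x b a) + theta_I g Gamma x b b.
Proof.
move=> Ox; have dC := costar_I_diff Ox.
pose A (c d : 'rV[R]_(N + M)) : 'rV[R]_(N + M) :=
  d *m 'D_(sharp g x c) (costar g (P_I g Gamma)) x.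
pose B (c d : 'rV[R]_(N + M)) : 'rV[R]_(N + M) :=
  \row_i (c *m 'D_(delta_mx 0 i) (ginv g) x *m d^T) 0 0.
have thetaE c d : theta_I g Gamma x c d =
    A c d - 2^-1 *: (B c d *m costar g (P_I g Gamma) x) by [].
have DD : 'D_(sharp g x (a + b)) (costar g (P_I g Gamma)) x =
    'D_(sharp g x a) (costar g (P_I g Gamma)) x +
    'D_(sharp g x b) (costar g (P_I g Gamma)) x.
  by rewrite /sharp mulmxDl !deriveE // linearD.
have AD : A (a + b) (a + b) = A a a + (A a b + A b a) + A b b.
  rewrite /A DD; move: ('D__ _ _) ('D__ _ _) => Da Db.
  by rewrite mulmxDr !mulmxDl !addrA.
have quad (Q : 'M[R]_(N + M)) : ((a + b) *m Q *m (a + b)^T) 0 0 =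
    (a *m Q *m a^T) 0 0 + ((a *m Q *m b^T) 0 0 + (b *m Q *m a^T) 0 0) +
    (b *m Q *m b^T) 0 0.
  rewrite raddfD /= !mulmxDl !mulmxDr.
  move: (a *m Q *m a^T) (a *m Q *m b^T) (b *m Q *m a^T) (b *m Q *m b^T).
  by move=> aa ab ba bb; rewrite !mxE !addrA.
have BE c d i : B c d 0 i = (c *m 'D_(delta_mx 0 i) (ginv g) x *m d^T) 0 0.
  by rewrite mxE.
(* A and B contain directional derivatives, which would otherwise be unfolded
   by the rewriting below. *)
clearbody A B.
have BD : B (a + b) (a + b) = B a a + (B a b + B b a) + B b b.
  by apply/rowP => i; rewrite BE quad -!BE !mxE.
rewrite !thetaE AD BD !mulmxDl !scalerDr !opprD.
rewrite addrACA; congr (_ + _); rewrite addrACA; congr (_ + _).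
by rewrite addrACA.
Qed.

(** The product rule for p P_I^*.  The derivative of P_I^* along the motion and
    the projection of dH/dq are the two terms of theta_I[p, p], so what remains
    is the projection of the defect dp + dH/dq, namely of force and reaction. *)
Lemma has_deriv_on_costar_I (I : set R) (q p : R -> 'rV[R]_(N + M)) t dp :
  O (q t) -> has_deriv_on I q t (sharp g (q t) (p t)) ->
  has_deriv_on I p t dp ->
  has_deriv_on I (fun s => p s *m costar g (P_I g Gamma) (q s)) t
    (theta_I g Gamma (q t) (p t) (p t) +
     (dp + gradient (fun x => Hamiltonian g x (p t)) (q t)) *m
       costar g (P_I g Gamma) (q t)).
Proof.
move=> Oq dq dp'; have dC := costar_I_diff Oq.
have alg (a b d : 'rV[R]_(N + M)) (C : 'M[R]_(N + M)) :
    a - 2^-1 *: (b *m C) + (d + 2^-1 *: b) *m C = d *m C + a.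
  by rewrite mulmxDl -scalemxAl addrACA [- _ + _]addrC subrr addr0 addrC.
have -> : theta_I g Gamma (q t) (p t) (p t) +
     (dp + gradient (fun x => Hamiltonian g x (p t)) (q t)) *m
       costar g (P_I g Gamma) (q t) =
    dp *m costar g (P_I g Gamma) (q t) +
    p t *m 'd (costar g (P_I g Gamma)) (q t) (sharp g (q t) (p t)).
  by rewrite gradient_Hamiltonian_q // -deriveE //; exact: alg.
exact: has_deriv_on_mulmx dp' (has_deriv_on_comp dC dq).
Qed.
Lemma flat_costar (P : 'rV[R]_(N + M) -> 'M[R]_(N + M)) x v : O x ->
  flat g x v *m costar g P x = flat g x (v *m P x).
Proof. by move=> Ox; rewrite /flat /costar !mulmxA mulmxK ?g_unit. Qed.

Lemma flat_inj x v w : O x -> flat g x v = flat g x w -> v = w.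
Proof.
by move=> Ox /(congr1 (mulmx^~ (invmx (g x)))); rewrite !mulmxK ?g_unit.
Qed.

Lemma sharp_flat x v : O x -> sharp g x (flat g x v) = v.
Proof. by move=> Ox; rewrite /sharp /flat mulmxK ?g_unit. Qed.

Lemma velocity_split x (v : 'rV[R]_(N + M)) : O x -> v *m P_II g Gamma x = 0 ->
  v = v *m P_I g Gamma x + v *m P_III g Gamma x.
Proof.
move=> Ox; rewrite P_IE // P_IIE // P_IIIE // mulmxBr mulmx1.
by move=> /eqP; rewrite subr_eq0 => /eqP {1}->; rewrite -mulmxDr subrK.
Qed.

Lemma momentum_split x v a : O x -> v *m P_II g Gamma x = 0 ->
    v *m P_III g Gamma x = h_map g Gamma x a ->
  flat g x v =
    flat g x v *m costar g (P_I g Gamma) x + k_map g Gamma x a.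
Proof.
move=> Ox vII vIII; rewrite flat_costar // /k_map -vIII -mulmxDl.
by rewrite -velocity_split.
Qed.

Lemma theta_split x v a : O x -> v *m P_II g Gamma x = 0 ->
    v *m P_III g Gamma x = h_map g Gamma x a ->
  let p_I := flat g x v *m costar g (P_I g Gamma) x in
  theta_I g Gamma x (flat g x v) (flat g x v) =
  theta_I g Gamma x p_I p_I + Upsilon g Gamma x p_I a + Psi g Gamma x a a.
Proof.
by move=> Ox vII vIII p_I; rewrite {1 2}(momentum_split Ox vII vIII) theta_ID.
Qed.

Lemma constraint_II x v : O x -> (v <= Gamma x)%MS -> v *m P_II g Gamma x = 0.
Proof.
by move=> Ox vG; rewrite P_IIE // mulmxBr mulmx1 mulmxA constraint_fixed // subrr.
Qed.

Lemma constraint_III x v : O x -> (v <= Gamma x)%MS ->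
  v *m P_III g Gamma x = h_map g Gamma x (v *m Dpi x).
Proof.
by move=> Ox vG; rewrite P_IIIE // h_mapE // !mulmxA constraint_fixed.
Qed.

Lemma P_I_Dpi x v : v *m P_I g Gamma x *m Dpi x = 0.
Proof.
apply/sub_kermxP; apply: submx_trans (capmxSl _ (Gamma x)).
exact: proj_mx_sub.
Qed.

Lemma constraint_flat x v a : O x -> v *m P_II g Gamma x = 0 ->
    v *m P_III g Gamma x = h_map g Gamma x a ->
  (v <= Gamma x)%MS /\ v *m Dpi x = a.
Proof.
move=> Ox vII vIII; rewrite (velocity_split Ox vII); split.
  apply: addmx_sub; apply: submx_trans (proj_mx_sub _ _ _) _; exact: capmxSr.
by rewrite mulmxDl P_I_Dpi add0r vIII h_mapE // -mulmxA lift_mx_Dpi // mulmx1.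
Qed.

(** * The equations of motion *)

Section Dynamics.
Context {F : R -> 'rV[R]_(N + M) -> 'rV[R]_(N + M) -> 'rV[R]_(N + M)}.
Context {I : set R} (I_itv : time_interval I).
Context {u : R -> 'rV[R]_M} (u_C1 : C1_on I u).
Context {q : R -> 'rV[R]_(N + M)} (q_C1 : C1_on I q).
Hypothesis q_chart : forall t, I t -> O (q t).
Let du := deriv_on I u.
Let dq := deriv_on I q.
Let p t := flat g (q t) (dq t).

Let q_deriv t : I t -> has_deriv_on I q t (sharp g (q t) (p t)).
Proof.
by move=> It; rewrite sharp_flat; [case: q_C1 => + _; apply | exact: q_chart].
Qed.

Lemma chart_pi_deriv t : I t ->
  has_deriv_on I (fun s => chart_pi (q s)) t (dq t *m Dpi (q t)).
Proof.
move=> It; rewrite mul_Dpi chart_piE.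
have := has_deriv_on_comp (differentiable_rsubmx (q t)) (q_C1.1 t It).
by rewrite (diff_lin _ (@continuous_rsubmx _ _ _ _)).
Qed.

(** Admissible velocities lie in Gamma and project to du, which determines their
    II- and III-components; the I-component of the momentum equation is the
    only one that the reaction does not enter. *)
Lemma nonholonomic_reduced : nonholonomic_solution g Gamma F I u q p ->
  reduced_equations g Gamma F I du q dq p.
Proof.
move=> [rho sol] t It; have [dq_t dp_t _ pGamma rhoR] := sol t It.
have Oq := q_chart It.
have dqGamma : (dq t <= Gamma (q t))%MS.
  have /submxP[B] := pGamma; rewrite mulmxA => /(flat_inj Oq) ->.
  exact: submxMl.
have dqII := constraint_II Oq dqGamma.
have dqIII : dq t *m P_III g Gamma (q t) = h_map g Gamma (q t) (du t).
  rewrite constraint_III //; congr h_map.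
  apply: (has_deriv_on_unique I_itv It (chart_pi_deriv It)).
  apply: (has_deriv_on_eq _ It) (u_C1.1 t It) => s Is.
  by case: (sol s Is).
split=> //.
  by rewrite flat_costar // sharp_flat.
have := has_deriv_on_costar_I Oq (q_deriv It) dp_t.
rewrite (theta_split Oq dqII dqIII); set G := gradient _ _.
have -> : - G + F t (q t) (p t) + rho t + G = F t (q t) (p t) + rho t.
  by rewrite addrC -addrA addrA subrr add0r.
move: rhoR; rewrite (reaction_sumP Oq) => /eqP rho0.
by rewrite mulmxDl rho0 addr0.
Qed.

(** The momentum is p_I + k(du): the equations give the derivative of the first
    summand, and the second is differentiable because du is. *)
Lemma p_deriv : differentiable_on I du ->
  reduced_equations g Gamma F I du q dq p ->
  forall t, I t -> has_deriv_on I p t (deriv_on I p t).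
Proof.
move=> du_diff red t It.
have Oq := q_chart It; have [_ _ _ dpI] := red t It.
have dL := has_deriv_on_comp (lift_mx_diff Oq) (q_C1.1 t It).
have dg := has_deriv_on_comp (g_diff Oq) (q_C1.1 t It).
have dk := has_deriv_on_mulmx (has_deriv_on_mulmx (du_diff t It) dL) dg.
have := has_deriv_onD dpI dk; set l := (_ + _) => dp.
suff dp' : has_deriv_on I p t l by rewrite (deriv_on_eq I_itv It dp').
apply: has_deriv_on_eq It dp => s Is; have Oqs := q_chart Is.
have [dqII dqIII _ _] := red s Is.
by rewrite [RHS](momentum_split Oqs dqII dqIII) /k_map h_mapE.
Qed.

(** The velocity of the projected path is D pi(h(du)) = du, so the difference
    between this path and the control is constant. *)
Lemma chart_pi_follows : reduced_equations g Gamma F I du q dq p ->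
  (exists t0, I t0 /\ forall alpha : 'I_M,
     q t0 0 (rshift N alpha) = u t0 0 alpha) ->
  forall t, I t -> chart_pi (q t) = u t.
Proof.
move=> red [t0 [It0 qu0]] t It; apply/rowP => alpha; apply/eqP.
pose f s : R := chart_pi (q s) 0 alpha + -1 *: u s 0 alpha.
have f_cst : f t = f t0.
  apply: (has_deriv_on0_cst I_itv) => // s Is.
  have [dqII dqIII _ _] := red s Is.
  have [_ Ddq] := constraint_flat (q_chart Is) dqII dqIII.
  have dpi := has_deriv_on_entry (i := 0) (j := alpha) (chart_pi_deriv Is).
  have dus := has_deriv_on_entry (i := 0) (j := alpha) (u_C1.1 s Is).
  have := has_deriv_onD dpi (has_deriv_onZ (k := -1) dus).
  by rewrite Ddq /du scaleN1r subrr.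
rewrite -subr_eq0; move: f_cst; rewrite /f !scaleN1r => ->.
by rewrite mxE qu0 subrr.
Qed.

(** The reaction is defined as the defect dp + dH/dq - F.  Its I-component
    vanishes by comparing the two expressions of the derivative of p_I. *)
Lemma reduced_nonholonomic : differentiable_on I du ->
  reduced_equations g Gamma F I du q dq p ->
  (exists t0, I t0 /\ forall alpha : 'I_M,
     q t0 0 (rshift N alpha) = u t0 0 alpha) ->
  nonholonomic_solution g Gamma F I u q p.
Proof.
move=> du_diff red qu0.
exists (fun t => deriv_on I p t +
  gradient (fun x => Hamiltonian g x (p t)) (q t) - F t (q t) (p t)) => t It.
have Oq := q_chart It; have [dqII dqIII _ dpI] := red t It.
have dp := p_deriv du_diff red It.
have [dqGamma _] := constraint_flat Oq dqII dqIII.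
split.
- by rewrite gradient_Hamiltonian_p //; exact: q_deriv.
- set G := gradient _ _; set f := F t _ _.
  suff -> : - G + f + (deriv_on I p t + G - f) = deriv_on I p t by [].
  by rewrite addrC [- G + f]addrC addrA subrK addrK.
- exact: chart_pi_follows.
- exact: submxMr.
rewrite reaction_sumP //; set G := gradient _ _; set f := F t _ _.
have := has_deriv_on_costar_I Oq (q_deriv It) dp.
rewrite (theta_split Oq dqII dqIII) => dpI'.
have := has_deriv_on_unique I_itv It dpI dpI'.
by move=> /addrI fG; rewrite mulmxBl -fG subrr.
Qed.

End Dynamics.
End Geometry.

(* The "if" half is stated for controls whose derivative du is itself
   differentiable.  This is necessary: a nonholonomic solution has p, hence
   du = Dpi (g^{-1} p), differentiable, whereas (i)-(ii) with a control that
   is only C^1 leave p_III = k(du) possibly non-differentiable. *)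
Theorem theorem4p1 (R : realType) (N M nu : nat)
    (N_gt0 : (0 < N)%N) (M_gt0 : (0 < M)%N) (nu_gt0 : (0 < nu)%N)
    (O : set 'rV[R]_(N + M)) (O_open : open O)
    (g : 'rV[R]_(N + M) -> 'M[R]_(N + M)) (g_metric : riemannian_metric O g)
    (Gamma : 'rV[R]_(N + M) -> 'M[R]_(N + M))
    (Gamma_distr : smooth_distribution O (N + M - nu)%N Gamma)
    (transversality : forall x, O x -> (Delta x + Gamma x :=: 1%:M)%MS)
    (F : R -> 'rV[R]_(N + M) -> 'rV[R]_(N + M) -> 'rV[R]_(N + M))
    (I : set R) (I_interval : time_interval I)
    (u : R -> 'rV[R]_M) (u_C1 : C1_on I u)
    (q : R -> 'rV[R]_(N + M)) (q_C1 : C1_on I q)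
    (q_chart : forall t, I t -> O (q t)) :
  let du := deriv_on I u in
  let dq := deriv_on I q in
  let p := fun t => flat g (q t) (dq t) in
  let condition_i := reduced_equations g Gamma F I du q dq p in
  let condition_ii := exists t0, I t0 /\ forall alpha : 'I_M,
      q t0 0 (rshift N alpha) = u t0 0 alpha in
  [/\ nonholonomic_solution g Gamma F I u q p -> condition_i /\ condition_ii,
      differentiable_on I du -> condition_i /\ condition_ii ->
        nonholonomic_solution g Gamma F I u q p &
      forall t, I t ->
        (dq t *m P_II g Gamma (q t) = 0 <->
         p t *m costar g (P_II g Gamma) (q t) = 0) /\
        (dq t *m P_III g Gamma (q t) = h_map g Gamma (q t) (du t) <->
         p t *m costar g (P_III g Gamma) (q t) = k_map g Gamma (q t) (du t))].
Proof.
move=> du dq p condition_i condition_ii.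
have [S S_cometric] := cometric_exists O_open g_metric Gamma_distr.
split=> [sol|du_diff [red qu0]|t It].
- split; first exact: (nonholonomic_reduced O_open g_metric S_cometric).
  have [rho rho_sol] := sol; have [_ [t0 [_ [It0 _ _]]]] := I_interval.
  exists t0; split=> // alpha; have [_ _ <- _ _] := rho_sol t0 It0.
  by rewrite mxE.
- exact: (reduced_nonholonomic O_open g_metric S_cometric).
have Oq := q_chart t It.
rewrite !(flat_costar g_metric _ _ Oq) /k_map; split; split=> [->//|].
- by rewrite /flat mul0mx.
- by rewrite -[0 in RHS](mul0mx _ (g (q t))); exact: (flat_inj g_metric Oq).
- exact: (flat_inj g_metric Oq).
Qed.
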